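(* Let $S_U$ be a nonempty Schubert union in $G(2,m)$ over $F_q$, with affine spanning dimension $K$, and let $b=b_1$ be the largest number appearing in the sequence $\sigma_U: a_1<a_2<\dots<a_s<b_s<\dots<b_2<b_1$. Then the higher weights of the code $C_U$ satisfy $d_K=g_U(q)$ and $$d_{K-a}=g_U(q)-(1+q+\dots+q^{a-1})\qquad\text{for }a=1,\dots,b-1.$$
   Context: Let $V$ be an $m$-dimensional vector space over $F_q$ with basis $e_1,\dots,e_m$ and $A_i=\mathrm{Span}(e_1,\dots,e_i)$. $G(2,m)$ is the Grassmann variety of $2$-dimensional subspaces of $V$ in its Plücker embedding in $\mathbf P^{k-1}$, $k=\binom m2$. For $1\le a<b\le m$ the Schubert cycle is $S_{(a,b)}=\{W\in G(2,m):\dim(W\cap A_a)\ge1,\ W\subset A_b\}$. A Schubert union $S_U$ is a finite union of Schubert cycles with respect to this fixed flag. Every nonempty Schubert union in $G(2,m)$ can be written uniquely as $S_U=S_{(a_1,b_1)}\cup\dots\cup S_{(a_s,b_s)}$ with $1\le a_1<a_2<\dots<a_s<b_s<\dots<b_2<b_1\le m$, and $\sigma_U$ is this sequence of $2s$ integers. $K$ is the dimension of the linear span of the affine cone over $S_U$ and $g_U(q)$ is the number of $F_q$-rational points of $S_U$. The code $C_U$ is the linear code over $F_q$ (up to equivalence) of length $g_U(q)$ and dimension $K$ with generator matrix the $K\times g_U(q)$ matrix whose columns are coordinate representatives of the $F_q$-points of $S_U$, obtained from their Plücker coordinates by deleting the $k-K$ Plücker coordinates vanishing identically on $S_U$. $d_r$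 denotes its $r$-th higher weight: the minimum cardinality of the support of an $r$-dimensional subcode ($d_0=0$). *)

(* Defs.v *)
From HB Require Import structures.
From mathcomp Require Import all_boot all_algebra.

Set Implicit Arguments.
Unset Strict Implicit.
Unset Printing Implicit Defensive.

Import GRing.Theory.
Local Open Scope ring_scope.

(* Subspaces over a finite field form a finite type, being represented by     *)
(* canonical square matrices; so sets of F_q-points are finite sets.          *)
Import VectorInternalTheory.
HB.instance Definition _ (F : finFieldType) (V : vectType F) :=
  [Countable of {vspace V} by <:].
HB.instance Definition _ (F : finFieldType) (V : vectType F) :=
  [Finite of {vspace V} by <:].

Section SchubertUnion.

Variables (F : finFieldType) (V : vectType F) (m : nat) (e : m.-tuple V).

Implicit Types (W : {vspace V}) (S : {set {vspace V}}).

Definition flag (i : nat) : {vspace V} := <<take i e>>%VS.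

Definition grassmannian2 : {set {vspace V}} := [set W | \dim W == 2].

Definition schubert_cycle (a b : nat) : {set {vspace V}} :=
  [set W in grassmannian2 |
    (0 < \dim (W :&: flag a))%N && (W <= flag b)%VS].

Definition is_schubert_union S : Prop :=
  exists2 U : seq (nat * nat),
    all (fun ab => [&& 1 <= ab.1, ab.1 < ab.2 & ab.2 <= m]%N) U &
    S = \bigcup_(ab <- U) schubert_cycle ab.1 ab.2.

(* sigma is the increasing sequence a_1 < ... < a_s < b_s < ... < b_1, with   *)
(* s >= 1, so that a_i = sigma`_(i - 1) and b_i = sigma`_(2s - i).            *)
Definition is_schubert_seq S (sigma : seq nat) : Prop :=
  exists2 s : nat, (0 < s)%N &
  [/\ size sigma = s.*2, sorted ltn sigma,
      all (fun x => 1 <= x <= m)%N sigma &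
      S = \bigcup_(i < s)
            schubert_cycle (nth 0%N sigma i) (nth 0%N sigma (s.*2 - i.+1))].

Definition plucker_index : {set 'I_m * 'I_m} :=
  [set p : 'I_m * 'I_m | (p.1 < p.2)%N].

Definition plucker_coord (u : 2.-tuple V) (p : 'I_m * 'I_m) : F :=
  \det (\matrix_(r < 2, c < 2)
          coord e (if c == 0 then p.1 else p.2) (tnth u r)).

Definition plucker (u : 2.-tuple V) : 'rV[F]_#|plucker_index| :=
  \row_i plucker_coord u (enum_val i).

(* B picks a basis of each W in S. Changing this basis multiplies the         *)
(* Pluecker vector of W by the determinant of the base change, which can be   *)
(* any nonzero scalar: choosing B amounts to choosing a coordinate            *)
(* representative of each point of S.                                         *)
Variables (B : {vspace V} -> 2.-tuple V) (S : {set {vspace V}}).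

Definition span_dim : nat := \dim <<[seq plucker (B W) | W in S]>>.

Definition nonvanishing_coords : {set 'I_m * 'I_m} :=
  [set p in plucker_index | [exists W in S, plucker_coord (B W) p != 0]].

Definition generator_matrix : 'M[F]_(#|nonvanishing_coords|, #|S|) :=
  \matrix_(i, j) plucker_coord (B (enum_val j)) (enum_val i).

Definition schubert_code : {vspace 'rV[F]_#|S|} :=
  <<[seq row i generator_matrix | i : 'I_#|nonvanishing_coords|]>>%VS.

End SchubertUnion.

Section HigherWeight.

Variables (F : finFieldType) (n : nat).

Definition code_support (D : {vspace 'rV[F]_n}) : {set 'I_n} :=
  [set j | [exists c : 'rV[F]_n, (c \in D) && (c 0 j != 0)]].

(* d_r = d; in particular C has an r-dimensional subcode. *)
Definition higher_weight (C : {vspace 'rV[F]_n}) (r d : nat) : Prop :=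
  (exists D : {vspace 'rV[F]_n},
     [/\ (D <= C)%VS, \dim D = r & #|code_support D| = d]) /\
  (forall D : {vspace 'rV[F]_n},
     (D <= C)%VS -> \dim D = r -> (d <= #|code_support D|)%N).

End HigherWeight.

(* Main.v *)
Require Import Defs.
From mathcomp Require Import all_boot all_algebra all_field.
From mathcomp Require Import ring zify.

Set Implicit Arguments.
Unset Strict Implicit.
Unset Printing Implicit Defensive.

Import GRing.Theory.

(**
The columns of the generator matrix are the points of S, seen as a projective
system in a space of dimension K. A subcode D of dimension K - a consists of
codewords vanishing at the coordinates outside its support, so restricting C
to these coordinates leaves a code of dimension at most a; equivalently, the
corresponding points of S span a linear space of dimension at most a. As the
points are pairwise distinct in projective space, there are at most
1 + q + ... + q^(a-1) of them ([leq_card_support]). Hence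
d_(K-a) >= g - (1 + q + ... + q^(a-1)), for every projective system.

Equality holds as soon as the system contains all points of some projective
subspace of dimension a - 1 ([higher_weight_projective_system]): the codewords
vanishing there form a space of dimension at least K - a. In a Schubert union,
such a subspace consists of the planes that contain e_1 and lie in A_(a+1);
as the basis is numbered from 0 below, e_1 appears as [e`_0].
These planes belong to S_(a_1,b_1) because a + 1 <= b_1. There are
1 + q + ... + q^(a-1) of them ([card_planes_through]), and on them only the
Pluecker coordinates (1, j) with 2 <= j <= a + 1 can be nonzero, so that they
span at most a dimensions ([dim_restrict_pencil]). The full support of C
itself is the case a = 0.

It remains to see that distinct planes have non-proportional Pluecker vectors
([plucker_inj]), and that the code has dimension K ([dim_schubert_code]).
*)

(** * Counting points and lines over a finite field *)

Section Counting.

Local Open Scope ring_scope.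

Variables (F : finFieldType) (V : vectType F).
Implicit Types U W : {vspace V}.

Lemma card_vspace_set U :
  #|[set x : finvect_type V | x \in U]| = (#|F| ^ \dim U)%N.
Proof.
(* [card_vspace] asks for an explicitly packed vector space on a finite type. *)
case: V U => T cT U; rewrite cardsE.
by rewrite -(@card_vspace F (finvect_type (Vector.Pack cT)) cT U); apply: eq_card.
Qed.

(** The nonzero multiples of the [f i] are pairwise distinct nonzero vectors of
    [U], which has [q ^ \dim U - 1] nonzero vectors. *)
Lemma leq_card_noncollinear (I : finType) (Z : {set I}) (f : I -> V) U :
    (forall i, i \in Z -> f i \in U) -> (forall i, f i != 0) ->
    (forall i j c, f i = c *: f j -> i = j) ->
  (#|Z| <= \sum_(i < \dim U) #|F| ^ i)%N.
Proof.
move=> fU f_neq0 f_inj.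
have q_gt1 : (1 < #|F|)%N := finNzRing_gt1 F.
have q1_gt0 : (0 < #|F|.-1)%N by rewrite -ltnS prednK // ltnW.
rewrite -(leq_pmul2l q1_gt0) -predn_exp -(cardsC1 (0 : F)) -card_vspace_set mulnC.
set U0 := [set x : finvect_type V | x \in U].
have U0_0 : (0 : finvect_type V) \in U0 by rewrite inE; apply: (mem0v U).
rewrite (cardsD1 (0 : finvect_type V)) U0_0 /= -cardsX.
pose h (p : I * F) : finvect_type V := p.2 *: f p.1.
rewrite -(card_in_imset (f := h)).
  apply/subset_leq_card/subsetP=> _ /imsetP[[i c] /setXP[iZ c0] ->].
  rewrite !inE in c0 *; apply/andP; split; last exact/memvZ/fU.
  by apply: contraNneq (f_neq0 i) => /eqP; rewrite scaler_eq0 (negPf c0).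
move=> [i c] [j d] /setXP[/= _ c0] /setXP[/= _ d0]; rewrite /h /= => eq_h.
rewrite !inE in c0 d0.
have eij : i = j.
  apply: (f_inj _ _ (c^-1 * d)); rewrite -scalerA -[RHS](congr1 ( *:%R c^-1) eq_h).
  by rewrite scalerA mulVf // scale1r.
congr pair => //; apply/eqP; move/eqP: eq_h; rewrite eij -subr_eq0 -scalerBl.
by rewrite scaler_eq0 (negPf (f_neq0 j)) orbF subr_eq0.
Qed.

Lemma dim_line_add (x w : V) :
  x != 0 -> w \notin <[x]>%VS -> \dim (<[x]> + <[w]>) = 2.
Proof.
move=> x0 wx; have : free [:: w; x].
  by rewrite free_cons span_seq1 wx free_cons span_nil memv0 x0 nil_free.
by rewrite /free span_cons span_seq1 addvC => /eqP.
Qed.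

(** The planes through [x] in [U] are the points of the projective space of
    [U / <[x]>]. The count avoids quotients: sending [w] outside [<[x]>] to the
    plane [<[x]> + <[w]>] maps [q ^ \dim U - q] vectors onto these planes, with
    [q ^ 2 - q] vectors over each of them. *)
Lemma card_planes_through U (x : V) : x != 0 -> x \in U ->
  #|[set W : {vspace V} | [&& \dim W == 2, x \in W & (W <= U)%VS]]|
    = (\sum_(i < (\dim U).-1) #|F| ^ i)%N.
Proof.
move=> x0 xU; set L := [set W | _]; set q := #|F|.
have q_gt1 : (1 < q)%N := finNzRing_gt1 F.
have q_gt0 : (0 < q)%N := ltnW q_gt1.
have q1_gt0 : (0 < q.-1)%N by rewrite -ltnS prednK.
have dim_gt0 : (0 < \dim U)%N.
  by rewrite lt0n dimv_eq0; apply: contraNneq x0 => U0; rewrite -memv0 -U0.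
pose N W := [set w : finvect_type V | (w \in W) && (w \notin <[x]>%VS)].
have cardN W : x \in W -> #|N W| = (q * (q ^ (\dim W).-1).-1)%N.
  move=> xW; have W_gt0 : (0 < \dim W)%N.
    by rewrite lt0n dimv_eq0; apply: contraNneq x0 => W0; rewrite -memv0 -W0.
  rewrite -subn1 mulnBr muln1 -expnS prednK // -!card_vspace_set.
  have -> : N W = [set w : finvect_type V | w \in W]
                    :\: [set w : finvect_type V | w \in <[x]>%VS].
    by apply/setP=> w; rewrite !inE andbC.
  rewrite cardsDS ?card_vspace_set ?dim_vline ?x0 ?expn1 //.
  by apply/subsetP=> w; rewrite !inE => /vlineP[c ->]; apply: memvZ.
pose join (w : V) : {vspace V} := (<[x]> + <[w]>)%VS.
have join_sub w W : x \in W -> w \in W -> (join w <= W)%VS.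
  by move=> xW wW; rewrite subv_add -!memvE xW.
have fiber W : W \in L -> [set w in N U | join w == W] = N W.
  rewrite inE => /and3P[/eqP dimW xW WU]; apply/setP=> w; rewrite !inE.
  apply/idP/idP=> [/andP[/andP[wU wx] /eqP<-] | /andP[wW wx]].
    by rewrite wx andbT; apply: (subvP (addvSr _ _)); apply: memv_line.
  rewrite wx (subvP WU) //= eqEdim join_sub //=.
  by rewrite dim_line_add ?dimW.
have : #|N U| = (#|L| * (q * q.-1))%N.
  rewrite -sum1_card (partition_big (join : finvect_type V -> _) (mem L)) /=.
    rewrite -sum_nat_const; apply: eq_bigr => W WL.
    rewrite sum1dep_card fiber // cardN; move: WL; rewrite inE.
      by case/and3P=> /eqP-> _ _; rewrite expn1.
    by case/and3P.
  move=> w; rewrite !inE => /andP[wU wx].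
  by rewrite dim_line_add // join_sub //= memvE addvSl.
rewrite cardN // predn_exp mulnA [RHS]mulnC => /eqP.
by rewrite eqn_pmul2l ?muln_gt0 ?q_gt0 // => /eqP->.
Qed.

End Counting.

(** * Higher weights of codes from projective systems *)

Section ProjectiveSystem.

Local Open Scope ring_scope.

Lemma dim_span_row (F : fieldType) k n (A : 'M[F]_(k, n)) :
  \dim <<[seq row i A | i : 'I_k]>> = \rank A.
Proof.
have sub_row m (D : 'M[F]_(m, n)) (v : 'rV_n) :
    (v <= D)%MS -> v \in <<[seq row i D | i : 'I_m]>>%VS.
  case/submxP=> d ->; rewrite mulmx_sum_row; apply: memv_suml => i _.
  by apply/memvZ/memv_span/map_f/mem_enum.
have span_rowS m m' (D : 'M[F]_(m, n)) (D' : 'M[F]_(m', n)) : (D <= D')%MS ->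
    (<<[seq row i D | i : 'I_m]>> <= <<[seq row i D' | i : 'I_m']>>)%VS.
  move=> sDD'; apply/span_subvP=> _ /imageP[i _ ->].
  exact/sub_row/(submx_trans (row_sub i D)).
have -> : <<[seq row i A | i : 'I_k]>>%VS
            = <<[seq row i (row_base A) | i : 'I_(\rank A)]>>%VS.
  by apply: subv_anti; rewrite !span_rowS ?eq_row_base.
have sz : size [seq row i (row_base A) | i : 'I_(\rank A)] = \rank A.
  by rewrite size_image card_ord.
suff /eqP-> : free [seq row i (row_base A) | i : 'I_(\rank A)] by [].
have /eqP/= sz' := sz.
apply/(@freeP _ _ _ (Tuple sz')) => c.
rewrite (eq_bigr (fun i => (\row_i c i) 0 i *: row i (row_base A))) => [|i _].
  rewrite -mulmx_sum_row => /eqP; rewrite mulmx_free_eq0 ?row_base_free //.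
  by move/eqP/rowP=> c0 i; have := c0 i; rewrite !mxE.
rewrite mxE /= (nth_map i) ?size_enum_ord // nth_ord_enum //.
Qed.

Variables (F : finFieldType) (k n : nat) (G : 'M[F]_(k, n)).
Implicit Types (T : {set 'I_n}) (D : {vspace 'rV[F]_n}).

Let C : {vspace 'rV[F]_n} := <<[seq row i G | i : 'I_k]>>%VS.

Definition restrict T : 'End('rV[F]_n) :=
  linfun (mulmxr (diag_mx (\row_j (j \in T)%:R))).

Lemma restrictE T c j : restrict T c 0 j = if j \in T then c 0 j else 0.
Proof.
rewrite lfunE /= mul_mx_diag !mxE.
by case: ifP => _; rewrite ?mulr1 ?mulr0.
Qed.

Lemma restrict_eq0 T D :
  (D <= lker (restrict T))%VS = [disjoint T & code_support D].
Proof.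
apply/idP/idP=> [/subvP DT | /pred0P DT].
  apply/pred0P=> j /=; apply/negbTE/negP=> /andP[jT].
  rewrite inE => /existsP[c /andP[/DT]]; rewrite memv_ker => /eqP/rowP/(_ j).
  by rewrite restrictE jT mxE => ->; rewrite eqxx.
apply/subvP=> c cD; rewrite memv_ker; apply/eqP/rowP=> j; rewrite restrictE mxE.
case: ifP => // jT; apply: contraFeq (DT j) => cj /=; rewrite jT inE.
by apply/existsP; exists c; rewrite cD.
Qed.

(** Row rank equals column rank, for the columns of [G] indexed by [T]. *)
Lemma dim_restrict T :
  \dim (restrict T @: C) = \dim <<[seq row j G^T | j in T]>>.
Proof.
set E := diag_mx (\row_j (j \in T)%:R : 'rV[F]_n).
have -> : (restrict T @: C = <<[seq row i (G *m E) | i : 'I_k]>>)%VS.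
  rewrite limg_span -map_comp; congr span; apply: eq_map => i /=.
  by rewrite lfunE /= row_mul.
rewrite dim_span_row -mxrank_tr -dim_span_row; congr (\dim _).
have rowE j : row j (G *m E)^T = if j \in T then row j G^T else 0.
  apply/rowP=> i; rewrite /E !mxE (bigD1 j) //= big1 => [|l lj]; last first.
    by rewrite !mxE (negPf lj) mulr0.
  by rewrite !mxE eqxx addr0; case: ifP; rewrite !mxE ?mulr1 ?mulr0.
apply: subv_anti; apply/andP; split; apply/span_subvP=> _ /imageP[j jT ->].
  by rewrite rowE; case: ifP => jT'; [apply/memv_span/image_f | apply: mem0v].
have := rowE j; rewrite jT => <-; exact/memv_span/image_f.
Qed.

Hypothesis col_neq0 : forall j, row j G^T != 0.
Hypothesis col_noncollinear :
  forall i j c, row i G^T = c *: row j G^T -> i = j.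

(** Outside its support [D] vanishes, so that by rank-nullity [C] restricts
    there to a code of dimension at most [a]; the columns outside the support
    are then non-collinear vectors of a space of that dimension. *)
Lemma leq_card_support D a : (D <= C)%VS -> (\dim C <= \dim D + a)%N ->
  (n <= #|code_support D| + \sum_(i < a) #|F| ^ i)%N.
Proof.
move=> DC dimC; set Z := ~: code_support D.
have le_a : (\dim (restrict Z @: C) <= a)%N.
  rewrite -(leq_add2l (\dim (C :&: lker (restrict Z)))) limg_ker_dim.
  apply: leq_trans dimC _; rewrite leq_add2r dimvS // subv_cap DC restrict_eq0.
  by rewrite disjoints_subset subxx.
rewrite -[n in leqLHS]card_ord -(cardsC (code_support D)) leq_add2l.
apply: (@leq_trans (\sum_(i < \dim (restrict Z @: C)) #|F| ^ i)%N).
  rewrite dim_restrict.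
  apply: (leq_card_noncollinear (f := fun j => row j G^T)) => //.
  by move=> j jZ; apply/memv_span/image_f.
rewrite -(subnKC le_a) big_split_ord /=; exact: leq_addr.
Qed.

(** The hypotheses say that the columns indexed by [T] are all the points of a
    projective subspace of dimension [a - 1]. The codewords vanishing on [T]
    have dimension at least [\dim C - a], and any subspace of exactly that
    dimension reaches the bound of [leq_card_support]. *)
Lemma higher_weight_projective_system T a :
    #|T| = (\sum_(i < a) #|F| ^ i)%N -> (\dim (restrict T @: C) <= a)%N ->
  higher_weight C (\dim C - a) (n - #|T|).
Proof.
move=> cardT dimT; split; last first.
  move=> D DC dimD; rewrite leq_subLR addnC cardT; apply: leq_card_support => //.
  by rewrite dimD addnC -leq_subLR.
have [D0 [D0C D0T dimD0]] : exists D0 : {vspace 'rV[F]_n},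
    [/\ (D0 <= C)%VS, (D0 <= lker (restrict T))%VS & \dim D0 = (\dim C - a)%N].
  have := limg_ker_dim (restrict T) C; set E := (C :&: _)%VS => dimE.
  have freeE : free (take (\dim C - a) (vbasis E)).
    apply: (@catl_free _ _ (drop (\dim C - a) (vbasis E))).
    by rewrite cat_take_drop (basis_free (vbasisP E)).
  have DE : (<<take (\dim C - a) (vbasis E)>> <= E)%VS.
    by apply/span_subvP=> v /mem_take; apply: vbasis_mem.
  exists <<take (\dim C - a) (vbasis E)>>%VS.
  split; rewrite ?(subv_trans DE) ?capvSl ?capvSr //.
  rewrite (eqP freeE) size_takel // size_tuple leq_subLR -dimE addnC.
  by rewrite leq_add2r.
exists D0; split=> //; apply/eqP; rewrite eqn_leq; apply/andP; split.
  rewrite -[X in (X - _)%N]card_ord -(cardsC T) addKn subset_leq_card //.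
  by rewrite -disjoints_subset disjoint_sym -restrict_eq0.
rewrite leq_subLR addnC cardT; apply: leq_card_support => //.
by rewrite dimD0 addnC -leq_subLR.
Qed.

End ProjectiveSystem.

(** * Pluecker coordinates of planes *)

Section Plucker.

Local Open Scope ring_scope.

Variables (F : finFieldType) (V : vectType F) (m : nat) (e : m.-tuple V).
Hypothesis basis_e : basis_of fullv e.
Implicit Types (u : 2.-tuple V) (i j : 'I_m) (W : {vspace V}).

Lemma coord_full x : x = \sum_i coord e i x *: e`_i.
Proof. by apply: coord_basis basis_e _; apply: memvf. Qed.

Lemma coord_inj x y : (forall i, coord e i x = coord e i y) -> x = y.
Proof.
move=> xy; rewrite (coord_full x) (coord_full y).
by apply: eq_bigr => i _; rewrite xy.
Qed.

Lemma plucker_coordE u i j :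
  plucker_coord e u (i, j) =
    coord e i (tnth u ord0) * coord e j (tnth u ord_max)
    - coord e j (tnth u ord0) * coord e i (tnth u ord_max).
Proof.
rewrite /plucker_coord (expand_det_row _ ord0) !big_ord_recl big_ord0.
rewrite /cofactor !det_mx11 !mxE /=.
have -> : lift ord0 (ord0 : 'I_1) = (ord_max : 'I_2) by apply: val_inj.
by rewrite /= expr0 expr1; ring.
Qed.

(** The interior product of [u_0 ^ u_1] with the [i]-th vector of the dual
    basis: a vector of the plane spanned by [u] whose coordinates are the
    Pluecker coordinates with first index [i]. These vectors recover the plane
    from its Pluecker vector. *)
Definition contract u i : V :=
  coord e i (tnth u ord0) *: tnth u ord_max
  - coord e i (tnth u ord_max) *: tnth u ord0.

Lemma coord_contract u i j :
  coord e j (contract u i) = plucker_coord e u (i, j).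
Proof. by rewrite plucker_coordE raddfB /= !linearZ /= [X in _ - X]mulrC. Qed.

Lemma plucker_coord_flip u i j :
  plucker_coord e u (j, i) = - plucker_coord e u (i, j).
Proof. by rewrite !plucker_coordE; ring. Qed.

Lemma span_pair u x : x \in <<u>>%VS ->
  exists a b, x = a *: tnth u ord0 + b *: tnth u ord_max.
Proof.
move/coord_span=> ->; rewrite !big_ord_recl big_ord0 addr0 -!tnth_nth.
have -> : lift ord0 ord0 = ord_max :> 'I_2 by apply: val_inj.
by exists (coord u ord0 x), (coord u ord_max x).
Qed.

Lemma contract_mem u W i : basis_of W u -> contract u i \in W.
Proof. by move=> uW; rewrite rpredB // memvZ // (basis_mem uW) ?mem_tnth. Qed.

(** Cramer rule: both sides are linear in [x] and agree on the two vectors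
    of [u]. A nonzero Pluecker coordinate thus expresses the whole plane in
    terms of two of its contractions. *)
Lemma plucker_coord_scale u i j x : x \in <<u>>%VS ->
  plucker_coord e u (i, j) *: x
    = coord e j x *: contract u i - coord e i x *: contract u j.
Proof.
case/span_pair=> a [b ->]; apply: coord_inj => l.
rewrite raddfB /= !linearZ /= !coord_contract !plucker_coordE.
by rewrite !linearD !linearZ /=; ring.
Qed.

(** If all Pluecker coordinates vanish, then so do all contractions. Each of
    these is a linear relation between [u_0] and [u_1] whose coefficients are
    their coordinates, so that [u_0 = 0] by freeness. *)
Lemma plucker_coord_neq0 u :
  free u -> exists i j, plucker_coord e u (i, j) != 0.
Proof.
move=> free_u; suff /existsP[[i j] p_ij] : [exists p, plucker_coord e u p != 0].
  by exists i, j.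
apply: contraT => /existsPn p0.
have contract0 i : contract u i = 0.
  apply: coord_inj => j; rewrite coord_contract linear0.
  by apply/eqP/negPn/p0.
have coord0 i : coord e i (tnth u ord0) = 0.
  pose k (r : 'I_2) := if r == ord0 then - coord e i (tnth u ord_max)
                       else coord e i (tnth u ord0).
  apply: (elimT freeP free_u k) ord_max.
  rewrite -[RHS](contract0 i) !big_ord_recl big_ord0 addr0 /k /contract.
  have -> : lift ord0 ord0 = ord_max :> 'I_2 by apply: val_inj.
  by rewrite -!tnth_nth /= scaleNr addrC.
have := free_not0 free_u (mem_tnth ord0 u).
by move/eqP; case; apply: coord_inj => i; rewrite coord0 linear0.
Qed.


(** Proportional Pluecker vectors have proportional contractions, and these
    span the plane by [plucker_coord_scale]. *)
Lemma plucker_inj u u' W W' c : basis_of W u -> basis_of W' u' ->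
    (forall p, p \in plucker_index m ->
       plucker_coord e u p = c * plucker_coord e u' p) ->
  W = W'.
Proof.
move=> uW uW' eq_p.
have eq_p' i j : plucker_coord e u (i, j) = c * plucker_coord e u' (i, j).
  case: (ltngtP i j) => ij; first by apply: eq_p; rewrite inE.
    rewrite [LHS]plucker_coord_flip [X in c * X]plucker_coord_flip mulrN.
    by rewrite eq_p ?inE.
  by rewrite (val_inj ij) !plucker_coordE; ring.
have contractE i : contract u i = c *: contract u' i.
  by apply: coord_inj => j; rewrite linearZ /= !coord_contract.
have [i [j p_ij]] := plucker_coord_neq0 (basis_free uW).
apply/eqP; rewrite eqEdim (size_basis uW) (size_basis uW') leqnn andbT.
rewrite -(span_basis uW); apply/subvP=> x xu.
rewrite -[x](scalerK p_ij) plucker_coord_scale // !contractE.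
by rewrite memvZ // rpredB // !memvZ // contract_mem.
Qed.

(** The coordinate is the determinant of the [i]-th and [j]-th coordinate forms
    on [W], which have [v] as a common zero. *)
Lemma plucker_coord_eq0 W u v i j : basis_of W u ->
    v \in W -> v != 0 -> coord e i v = 0 -> coord e j v = 0 ->
  plucker_coord e u (i, j) = 0.
Proof.
move=> uW; rewrite -(span_basis uW) => vW v0 iv jv; apply/eqP.
have := plucker_coord_scale i j vW; rewrite iv jv !scale0r subrr => /eqP.
by rewrite scaler_eq0 (negPf v0) orbF.
Qed.

(** * The flag and the Schubert code *)

Lemma dim_flag n : (n <= m)%N -> \dim (flag e n) = n.
Proof.
move=> nm; have : free (take n e ++ drop n e).
  by rewrite cat_take_drop (basis_free basis_e).
by move/catl_free/eqP; rewrite size_takel ?size_tuple.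
Qed.

Lemma flagS n n' : (n <= n')%N -> (flag e n <= flag e n')%VS.
Proof.
move=> le_n; rewrite /flag -(minn_idPl le_n) take_min.
by apply: sub_span => x /mem_take.
Qed.

Lemma mem_flag n (i : nat) : (i < n)%N -> (i < m)%N -> e`_i \in flag e n.
Proof.
move=> ltin ltim.
rewrite -(nth_take 0 ltin) memv_span // mem_nth // size_take size_tuple.
by case: ifP.
Qed.

Lemma coord_flag n i x : (n <= i)%N -> x \in flag e n -> coord e i x = 0.
Proof.
move=> le_ni; suff /subvP sub : (flag e n <= lker (linfun (coord e i : V -> F^o)))%VS.
  by move/sub; rewrite memv_ker lfunE => /eqP.
apply/span_subvP=> y /(nthP 0)[j]; rewrite size_take size_tuple => ltj <- {y}.
have [ltjn ltjm] : (j < n)%N /\ (j < m)%N.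
  by move: ltj; case: (ltnP n m) => ? ?; split; lia.
rewrite memv_ker lfunE /= nth_take //.
rewrite (coord_free (Ordinal ltjm) i) ?(basis_free basis_e) //.
by rewrite -val_eqE /= (ltn_eqF (leq_trans ltjn le_ni)).
Qed.

Variables (S : {set {vspace V}}) (B : {vspace V} -> 2.-tuple V).
Hypothesis basis_B : forall W, W \in S -> basis_of W (B W).
Local Notation G := (generator_matrix e B S).

Lemma plucker_coord_vanish W p : W \in S -> p \in plucker_index m ->
  p \notin nonvanishing_coords e B S -> plucker_coord e (B W) p = 0.
Proof.
move=> WS p_idx; rewrite inE p_idx /= negb_exists => /forallP/(_ W).
by rewrite WS /= negbK => /eqP.
Qed.

(** The Pluecker vectors are the rows of the transpose of the generator matrix,
    up to zero columns, so that this is row rank equals column rank. *)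
Lemma dim_schubert_code : \dim (schubert_code e B S) = span_dim e B S.
Proof.
pose M : 'M[F]_(#|S|, #|plucker_index m|) := \matrix_j plucker e (B (enum_val j)).
have -> : span_dim e B S = \rank M.
  rewrite -dim_span_row; congr (\dim _); apply: eq_span => x.
  apply/imageP/imageP=> [[W WS ->] | [j _ ->]].
    by exists (enum_rank_in WS W); rewrite // rowK enum_rankK_in.
  by exists (enum_val j); rewrite ?enum_valP // rowK.
rewrite -mxrank_tr -dim_span_row; congr (\dim _).
have sub_idx p : p \in nonvanishing_coords e B S -> p \in plucker_index m.
  by rewrite inE => /andP[].
apply: subv_anti; apply/andP; split; apply/span_subvP=> _ /imageP[i _ ->].
  have i_idx := sub_idx _ (enum_valP i).
  have -> : row i G = row (enum_rank_in i_idx (enum_val i)) M^T.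
    by apply/rowP=> j; rewrite !mxE enum_rankK_in.
  exact/memv_span/image_f.
case: (boolP (enum_val i \in nonvanishing_coords e B S)) => [i_nv | i_v].
  have -> : row i M^T = row (enum_rank_in i_nv (enum_val i)) G.
    by apply/rowP=> j; rewrite !mxE enum_rankK_in.
  exact/memv_span/image_f.
have -> : row i M^T = 0; last exact: mem0v.
by apply/rowP=> j; rewrite !mxE plucker_coord_vanish ?enum_valP.
Qed.

Lemma generator_matrix_col_noncollinear (i j : 'I_#|S|) c :
  row i G^T = c *: row j G^T -> i = j.
Proof.
move=> eq_ij; apply: enum_val_inj.
have [basis_i basis_j] := (basis_B (enum_valP i), basis_B (enum_valP j)).
apply: (plucker_inj (c := c) basis_i basis_j) => p p_idx.
case: (boolP (p \in nonvanishing_coords e B S)) => [p_nv | p_v]; last first.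
  by rewrite !plucker_coord_vanish ?enum_valP // mulr0.
by have /rowP/(_ (enum_rank_in p_nv p)) := eq_ij; rewrite !mxE enum_rankK_in.
Qed.

Lemma generator_matrix_col_neq0 (j : 'I_#|S|) : row j G^T != 0.
Proof.
have [i1 [i2 p_neq0]] := plucker_coord_neq0 (basis_free (basis_B (enum_valP j))).
apply: contra_neq p_neq0 => /rowP colj0.
have col0 p : p \in plucker_index m -> plucker_coord e (B (enum_val j)) p = 0.
  case: (boolP (p \in nonvanishing_coords e B S)) => [p_nv _ | p_v p_idx].
    by have := colj0 (enum_rank_in p_nv p); rewrite !mxE enum_rankK_in.
  by rewrite plucker_coord_vanish ?enum_valP.
case: (ltngtP i1 i2) => i12; first by rewrite col0 ?inE.
  by rewrite plucker_coord_flip col0 ?inE ?oppr0.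
by rewrite (val_inj i12) plucker_coordE subrr.
Qed.

(** On a plane [W] through [e`_0], a Pluecker coordinate [(p1, p2)] vanishes
    if [0 < p1], since both coordinate forms then kill [e`_0]; if [W] lies in
    [flag e a.+1] it also vanishes when [a < p2]. Only the [a] coordinates
    [(0, l)] with [0 < l <= a] remain. *)
Lemma dim_restrict_pencil (m_gt0 : (0 < m)%N) (a : nat) (T : {set 'I_#|S|}) :
    (forall j : 'I_#|S|, j \in T ->
       e`_0 \in enum_val j /\ (enum_val j <= flag e a.+1)%VS) ->
  (\dim (restrict F T @: schubert_code e B S) <= a)%N.
Proof.
move=> T_pencil; pose i0 := Ordinal m_gt0.
(* When [m <= l.+1], the default [i0] of [insubd] makes [w l] zero. *)
pose w (l : 'I_a) : 'rV[F]_#|S| :=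
  restrict F T (\row_t plucker_coord e (B (enum_val t)) (i0, insubd i0 l.+1)).
suff: (restrict F T @: schubert_code e B S <= <<[seq w l | l : 'I_a]>>)%VS.
  move/dimvS/leq_trans; apply.
  by rewrite (leq_trans (dim_span _)) // size_image card_ord.
rewrite limg_span -map_comp; apply/span_subvP=> _ /mapP[i _ ->] /=.
case E: (enum_val i) => [p1 p2].
have : (p1 < p2)%N by have := enum_valP i; rewrite E !inE => /andP[].
move=> lt12.
case: (boolP ((p1 == 0 :> nat) && (p2 <= a)%N)) => [/andP[p1_0 p2a] | p_out].
  have p2_gt0 : (0 < p2)%N by apply: leq_ltn_trans lt12.
  have p2a' : (p2.-1 < a)%N by rewrite prednK.
  have -> : restrict F T (row i G) = w (Ordinal p2a').
    congr (restrict F T _); apply/rowP=> t; rewrite !mxE E; congr plucker_coord.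
    congr pair; apply: val_inj; rewrite /= ?(eqP p1_0) //.
    by rewrite val_insubd /= prednK // ltn_ord.
  exact/memv_span/image_f.
suff -> : restrict F T (row i G) = 0 by exact: mem0v.
apply/rowP=> t; rewrite restrictE !mxE; case: ifP => // /T_pencil[e0t t_flag].
rewrite E; move: p_out; rewrite negb_and -lt0n -ltnNge => /orP[p1_gt0 | p2a].
  apply: (plucker_coord_eq0 (v := e`_0) (basis_B (enum_valP t))) => //.
  - by apply: free_not0 (basis_free basis_e) _; rewrite mem_nth ?size_tuple.
  - by rewrite (coord_free i0 p1) ?(basis_free basis_e) // -val_eqE /= ltn_eqF.
  - rewrite (coord_free i0 p2) ?(basis_free basis_e) // -val_eqE /= ltn_eqF //.
    exact: leq_trans lt12.
rewrite plucker_coordE !(coord_flag (i := p2) p2a).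
- by rewrite mulr0 mul0r subrr.
- by apply: (subvP t_flag); rewrite (basis_mem (basis_B (enum_valP t))) ?mem_tnth.
- by apply: (subvP t_flag); rewrite (basis_mem (basis_B (enum_valP t))) ?mem_tnth.
Qed.

End Plucker.

Theorem proposition8p3
  (F : finFieldType) (V : vectType F) (m : nat) (e : m.-tuple V)
  (basis_e : basis_of fullv e)
  (S : {set {vspace V}}) (S_union : is_schubert_union e S) (S_neq0 : S != set0)
  (sigma : seq nat) (sigma_S : is_schubert_seq e S sigma)
  (B : {vspace V} -> 2.-tuple V)
  (basis_B : forall W : {vspace V}, W \in S -> basis_of W (B W)) :
  let q := #|F| in
  let g := #|S| in
  let K := span_dim e B S in
  let C := schubert_code e B S in
  let b := last 0 sigma in
  higher_weight C K g /\
  (forall a : nat, 1 <= a <= b - 1 ->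
     exists2 d : nat, higher_weight C (K - a) d
       & d + \sum_(i < a) q ^ i = g).
Proof.
move=> q g K C b.
suff weights a : a <= b - 1 ->
    exists2 d, higher_weight C (K - a) d & d + \sum_(i < a) q ^ i = g.
  split; last by move=> a /andP[_]; apply: weights.
  by have [d] := weights 0 (leq0n _); rewrite subn0 big_ord0 addn0 => Kd <-.
move=> le_ab.
case: sigma_S => s s_gt0 [size_sigma sorted_sigma /allP range_sigma S_def].
have idx_lt : s.*2 - 1 < size sigma by rewrite size_sigma; lia.
have b_def : b = nth 0 sigma (s.*2 - 1) by rewrite /b -nth_last size_sigma -subn1.
have /andP[_ b_le_m] : 1 <= b <= m by apply: range_sigma; rewrite b_def mem_nth.
have /andP[a1_gt0 _] : 1 <= nth 0 sigma 0 <= m.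
  by apply: range_sigma; rewrite mem_nth // size_sigma; lia.
have b_gt1 : 1 < b.
  apply: leq_ltn_trans a1_gt0 _; rewrite b_def.
  by apply: (sorted_ltn_nth ltn_trans); rewrite // ?inE ?size_sigma; lia.
have m_gt0 : 0 < m by lia.
have free_e := basis_free basis_e.
have e0_neq0 : (e`_0 != 0)%R.
  by apply: free_not0 free_e _; rewrite mem_nth ?size_tuple.
pose L := [set W : {vspace V} |
  [&& \dim W == 2, (e`_0)%R \in W & (W <= flag e a.+1)%VS]].
have LS : L \subset S.
  apply/subsetP=> W; rewrite inE => /and3P[dimW e0W W_flag].
  rewrite S_def; apply/bigcupP; exists (Ordinal s_gt0) => //=.
  have le_a1b : a.+1 <= b by lia.
  rewrite !inE dimW /= -b_def (subv_trans W_flag (flagS _ le_a1b)) andbT.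
  rewrite lt0n dimv_eq0; apply: contraNneq e0_neq0 => cap0.
  by rewrite -memv0 -cap0 memv_cap e0W mem_flag.
have cardL : #|L| = \sum_(i < a) q ^ i.
  rewrite card_planes_through ?mem_flag // dim_flag //; lia.
pose T := [set j : 'I_#|S| | enum_val j \in L].
have cardT : #|T| = #|L|.
  rewrite -(card_imset _ enum_val_inj); apply: eq_card => W.
  apply/imsetP/idP=> [[j] | WL]; first by rewrite inE => ? ->.
  have WS := subsetP LS W WL.
  by exists (enum_rank_in WS W); rewrite ?[_ \in T]inE enum_rankK_in.
have T_pencil j : j \in T ->
    (e`_0)%R \in enum_val j /\ (enum_val j <= flag e a.+1)%VS.
  by rewrite !inE => /and3P[].
exists (g - #|T|).
  rewrite /K -dim_schubert_code; apply: higher_weight_projective_system.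
  - exact: generator_matrix_col_neq0.
  - exact: generator_matrix_col_noncollinear.
  - by rewrite cardT.
  - exact: dim_restrict_pencil.
by rewrite -cardL cardT subnK // subset_leq_card.
Qed.
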